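(* Let $K$ be a finite field, $R$ a finite dimensional $K$-algebra, and $M,N$ nonzero finitely generated left $R$-modules. Then $\mathrm{rk}_M=\mathrm{rk}_N$ if and only if $w_Q(M)=w_Q(N)$ for all $Q\in\mathrm{Ind}(R)$. In particular, $\mathrm{rk}_Q\ne\mathrm{rk}_P$ whenever $P\neq Q$ are distinct elements of $\mathrm{Ind}(R)$.
   Context: For a nonzero finitely generated left $R$-module $M$ and a $k\times l$ matrix $A$ over $R$, $\mathrm{rk}_M(A)$ is the $K$-rank of the linear map $M^l\to M^k$ given by $A$, divided by $\dim_K(M)$; $\mathrm{rk}_M=\mathrm{rk}_N$ means equality on all finite rectangular matrices over $R$. $\mathrm{Ind}(R)$ is the set of isomorphism classes of finitely generated indecomposable left $R$-modules. If $M\cong\bigoplus_{i=1}^sQ_i^{n_i}$ is the Krull–Schmidt decomposition with pairwise non-isomorphic indecomposables $Q_i$, then the weight of $Q_i$ in $M$ is $w_{Q_i}(M)=n_i\dim_K(Q_i)/\dim_K(M)$, and $w_Q(M)=0$ for every other $Q\in\mathrm{Ind}(R)$. *)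

(* Defs.v *)
From HB Require Import structures.
From mathcomp Require Import all_boot all_order all_algebra all_field.
From mathcomp Require Import boolp classical_sets.

Set Implicit Arguments.
Unset Strict Implicit.
Unset Printing Implicit Defensive.

Import GRing.Theory.
Local Open Scope ring_scope.

Section DirectSum.
Variables (R : nzRingType) (I : finType) (V : I -> lmodType R).

(* The library has module structures on {ffun I -> V} only for a constant V. *)
Definition dsum : Type := {dffun forall i, V i}.
HB.instance Definition _ := Choice.on dsum.

Implicit Types x y : dsum.
Definition dsum0 : dsum := [ffun i => 0 : V i].
Definition dsumN x : dsum := [ffun i => - x i : V i].
Definition dsumD x y : dsum := [ffun i => x i + y i : V i].
Definition dsumZ (a : R) x : dsum := [ffun i => a *: x i : V i].

Fact dsumDA : associative dsumD.
Proof. by move=> x y z; apply/ffunP=> i; rewrite !ffunE addrA. Qed.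
Fact dsumDC : commutative dsumD.
Proof. by move=> x y; apply/ffunP=> i; rewrite !ffunE addrC. Qed.
Fact dsum0D : left_id dsum0 dsumD.
Proof. by move=> x; apply/ffunP=> i; rewrite !ffunE add0r. Qed.
Fact dsumND : left_inverse dsum0 dsumN dsumD.
Proof. by move=> x; apply/ffunP=> i; rewrite !ffunE addNr. Qed.
HB.instance Definition _ :=
  GRing.isZmodule.Build dsum dsumDA dsumDC dsum0D dsumND.

Fact dsumZA a b x : dsumZ a (dsumZ b x) = dsumZ (a * b) x.
Proof. by apply/ffunP=> i; rewrite !ffunE scalerA. Qed.
Fact dsumZ1 : left_id 1 dsumZ.
Proof. by move=> x; apply/ffunP=> i; rewrite !ffunE scale1r. Qed.
Fact dsumZDr : right_distributive dsumZ +%R.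
Proof. by move=> a x y; apply/ffunP=> i; rewrite !ffunE scalerDr. Qed.
Fact dsumZDl x : {morph dsumZ^~ x : a b / a + b}.
Proof. by move=> a b; apply/ffunP=> i; rewrite !ffunE scalerDl. Qed.
HB.instance Definition _ :=
  GRing.Zmodule_isLmodule.Build R dsum dsumZA dsumZ1 dsumZDr dsumZDl.

End DirectSum.

Section Modules.
Variable R : nzRingType.

Definition finitely_generated (V : lmodType R) : Prop :=
  exists (n : nat) (g : 'I_n -> V),
    forall x : V, exists c : 'I_n -> R, x = \sum_i c i *: g i.

Record fgModule := FgModule {
  fg_sort :> lmodType R;
  fgP : finitely_generated fg_sort }.

Definition isomorphic (U V : lmodType R) : Prop :=
  exists f : {linear U -> V}, bijective f.

Definition nonzero (V : lmodType R) : Prop := exists x : V, x != 0.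

Definition indecomposable (V : lmodType R) : Prop :=
  nonzero V /\
  forall A B : lmodType R, isomorphic V (A * B)%type ->
    ~ (nonzero A /\ nonzero B).

Definition krull_schmidt_decomposition (M : lmodType R)
    (s : nat) (Q : 'I_s -> fgModule) (n : 'I_s -> nat) : Prop :=
  [/\ forall i, indecomposable (Q i),
      forall i j, isomorphic (Q i) (Q j) -> i = j,
      forall i, (0 < n i)%N
    & isomorphic M (dsum (fun i => {ffun 'I_(n i) -> Q i} : lmodType R))].

End Modules.

Section RestrictionOfScalars.
Variables (K : fieldType) (R : falgType K) (M : fgModule R).

(* M as a K-vector space, k acting as the element k%:A = k *: 1 of R. *)
Definition kspace : Type := M.
HB.instance Definition _ := GRing.Zmodule.on kspace.

Implicit Types x y : kspace.
Definition kscale (k : K) x : kspace := (k%:A : R) *: (x : M).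

Fact kscaleA a b x : kscale a (kscale b x) = kscale (a * b) x.
Proof. by rewrite /kscale scalerA -scalerAl mul1r scalerA. Qed.
Fact kscale1 : left_id 1 kscale.
Proof. by move=> x; rewrite /kscale scale1r scale1r. Qed.
Fact kscaleDr : right_distributive kscale +%R.
Proof. by move=> a x y; rewrite /kscale scalerDr. Qed.
Fact kscaleDl x : {morph kscale^~ x : a b / a + b}.
Proof. by move=> a b; rewrite /kscale scalerDl scalerDl. Qed.
HB.instance Definition _ :=
  GRing.Zmodule_isLmodule.Build K kspace kscaleA kscale1 kscaleDr kscaleDl.

Lemma kscaleE (k : K) x : k *: x = (k%:A : R) *: (x : M).
Proof. by []. Qed.

Definition kspans n : Prop :=
  exists b : 'I_n -> kspace,
    forall x, exists c : 'rV[K]_n, x = \sum_i c 0 i *: b i.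

Lemma kspans_ex : exists n, `[< kspans n >].
Proof.
have [n [g gP]] := fgP M.
pose T := ('I_n * 'I_(\dim {:R}))%type.
pose b (p : T) : kspace := (vbasis {:R})`_p.2 *: g p.1.
exists #|{: T}|; apply/asboolP; exists (b \o enum_val) => x.
have [c ->] := gP x.
exists (\row_p coord (vbasis {:R}) (enum_val p).2 (c (enum_val p).1)).
rewrite (eq_bigr (fun p : 'I_#|{: T}| =>
  coord (vbasis {:R}) (enum_val p).2 (c (enum_val p).1) *: b (enum_val p)));
  last by move=> p _; rewrite mxE.
rewrite -(big_enum_val (fun p : T =>
  coord (vbasis {:R}) p.2 (c p.1) *: b p)) /=.
rewrite (eq_bigl xpredT) // -(pair_bigA _ (fun i j =>
  coord (vbasis {:R}) j (c i) *: b (i, j))) /=.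
apply: eq_bigr => i _.
rewrite {1}(coord_vbasis (memvf (c i))) scaler_suml.
apply: eq_bigr => j _.
by rewrite kscaleE /b /= scalerA -scalerAl mul1r.
Qed.

Fact kspace_vect_iso : Vector.axiom (ex_minn kspans_ex) kspace.
Proof.
case: ex_minnP => n /asboolP/cid[b bP] nmin.
have b_free (c : 'rV[K]_n) : \sum_i c 0 i *: b i = 0 -> c = 0.
  move=> c0; apply/rowP => i0; rewrite mxE; apply/eqP/negP => /negP ci0.
  case: n b bP nmin c c0 i0 ci0 => [|n] b bP nmin c c0 i0 ci0; first by case: i0 ci0.
  suff /nmin: `[< kspans n >] by rewrite ltnn.
  apply/asboolP; exists (b \o lift i0) => x; have [d ->] := bP x.
  pose a := d 0 i0 / c 0 i0.
  exists (\row_i (d - a *: c) 0 (lift i0 i)).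
  transitivity (\sum_i (d - a *: c) 0 i *: b i).
    rewrite [RHS](eq_bigr (fun i => d 0 i *: b i - a *: (c 0 i *: b i))).
      by rewrite sumrB -scaler_sumr c0 scaler0 subr0.
    by move=> i _; rewrite !mxE scalerBl scalerA.
  rewrite (bigD1_ord i0) //= !mxE /a mulfVK // subrr scale0r add0r.
  by apply: eq_bigr => i _; rewrite !mxE.
have [v vP] := choice bP.
pose r (c : 'rV[K]_n) : kspace := \sum_i c 0 i *: b i.
have rB c d : r (c - d) = r c - r d.
  by rewrite /r -sumrB; apply: eq_bigr => i _; rewrite !mxE scalerBl.
have r_inj : injective r.
  by move=> c d /eqP; rewrite -subr_eq0 -rB => /eqP/b_free/subr0_eq.
exists v; last by exists r => x; [rewrite {2}(vP x) | apply: r_inj; rewrite -[LHS]vP].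
move=> a x y; apply: r_inj; rewrite -[LHS]vP {1}(vP x) {1}(vP y).
rewrite /r scaler_sumr -big_split; apply: eq_bigr => i _.
by rewrite !mxE scalerDl scalerA.
Qed.
HB.instance Definition _ := Lmodule_hasFinDim.Build K kspace kspace_vect_iso.

Definition kdim : nat := \dim {: kspace}.

Section MatrixAction.
Variables (k l : nat) (A : 'M[R]_(k, l)).

Definition mxact (x : {ffun 'I_l -> kspace}) : {ffun 'I_k -> kspace} :=
  [ffun i => \sum_j A i j *: (x j : M)].

Fact mxact_is_linear : linear mxact.
Proof.
move=> a x y; apply/ffunP => i; rewrite !ffunE scaler_sumr -big_split /=.
apply: eq_bigr => j _; rewrite !ffunE scalerDr !kscaleE; congr (_ + _).
by rewrite !scalerA -scalerAl -scalerAr mul1r mulr1.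
Qed.
HB.instance Definition _ := GRing.isLinear.Build K
  {ffun 'I_l -> kspace} {ffun 'I_k -> kspace} _ mxact mxact_is_linear.

Definition rk : rat := (\dim (limg (linfun mxact)))%:R / kdim%:R.

End MatrixAction.

End RestrictionOfScalars.

Section Weights.
Variables (K : fieldType) (R : falgType K).
Implicit Types M N Q : fgModule R.

Definition same_rk M N : Prop :=
  forall (k l : nat) (A : 'M[R]_(k, l)), rk M A = rk N A.

Definition is_weight Q M (w : rat) : Prop :=
  exists (s : nat) (P : 'I_s -> fgModule R) (n : 'I_s -> nat),
    krull_schmidt_decomposition M P n /\
    ((exists2 i, isomorphic Q (P i)
               & w = (n i)%:R * (kdim (P i))%:R / (kdim M)%:R)
     \/ (forall i, ~ isomorphic Q (P i)) /\ w = 0).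

(* By the Krull-Schmidt theorem exactly one w satisfies is_weight Q M w, so
   the default value 0 of xget is never taken. *)
Definition weight Q M : rat := xget 0 [set w | is_weight Q M w]%classic.

End Weights.

(* Main.v *)
(* A solution of a linear system over R in M is a homomorphism to M from the
   cokernel of its matrix, so rk_M encodes, up to the factor dim M, the numbers
   |Hom(X, M)| for all finite X. By Lovasz' counting argument these numbers
   determine M up to isomorphism: they give the number of homomorphisms with a
   prescribed kernel, hence produce an injection M -> N between modules of the
   same size. By Fitting's lemma an indecomposable summand of a direct sum of
   indecomposables is isomorphic to one of them; together with the additivity of
   nullities this lets one cancel isomorphic summands one at a time, and shows
   that the nullity functions of pairwise non-isomorphic indecomposables are
   linearly independent. Both the Krull-Schmidt theorem and the determination of
   the weights by rk_M follow, the latter by comparing M^(dim N) with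
   N^(dim M). *)
From HB Require Import structures.
Require Import Defs.
From mathcomp Require Import all_boot all_order all_algebra all_field.
From mathcomp Require Import boolp.

Set Implicit Arguments.
Unset Strict Implicit.
Unset Printing Implicit Defensive.

Import GRing.Theory Num.Theory.
Local Open Scope ring_scope.

(** * Summands and Fitting's lemma *)

Section FixedSubmodule.
Variables (R : nzRingType) (V : lmodType R) (g : {linear V -> V}).

(** For an idempotent [g] this is its image, in a decidable form that yields a subtype. *)
Definition fixed_pred : {pred V} := [pred x | g x == x].

Fact fixed_submod_closed : submod_closed fixed_pred.
Proof.
split=> [|a x y]; rewrite !inE ?linear0 // => /eqP gx /eqP gy.
by rewrite linearP gx gy.
Qed.
HB.instance Definition _ :=
  GRing.isSubmodClosed.Build R V fixed_pred fixed_submod_closed.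

Record fixed_submod := FixedSubmod {
  fixed_val :> V; _ : fixed_val \in fixed_pred }.
HB.instance Definition _ := [isSub for fixed_val].
HB.instance Definition _ := [Choice of fixed_submod by <:].
HB.instance Definition _ := [SubChoice_isSubLmodule of fixed_submod by <:].
End FixedSubmodule.

Section Summands.
Variable R : nzRingType.
Implicit Types (U V W : lmodType R) (Q : finLmodType R).

Definition summand U V : Prop :=
  exists (i : {linear U -> V}) (p : {linear V -> U}), cancel i p.

Lemma linear_bij_inv U V (f : {linear U -> V}) : bijective f ->
  exists g : {linear V -> U}, cancel f g /\ cancel g f.
Proof.
case=> g fK gK; have g_lin : linear g.
  by move=> a x y; apply: (can_inj fK); rewrite linearP !gK.
pose gl : {linear V -> U} := HB.pack g (GRing.isLinear.Build R V U _ g g_lin).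
by exists gl.
Qed.

Lemma isomorphicP U V : isomorphic U V <->
  exists (f : {linear U -> V}) (g : {linear V -> U}), cancel f g /\ cancel g f.
Proof.
split=> [[f /linear_bij_inv[g gP]]|[f [g [fK gK]]]]; first by exists f, g.
by exists f, g.
Qed.

Lemma isomorphic_refl U : isomorphic U U.
Proof. by exists idfun; exists idfun. Qed.

Lemma isomorphic_sym U V : isomorphic U V -> isomorphic V U.
Proof. by move=> /isomorphicP[f [g [fK gK]]]; exists g, f. Qed.

Lemma isomorphic_trans V U W :
  isomorphic U V -> isomorphic V W -> isomorphic U W.
Proof. by move=> [f fbij] [g gbij]; exists (g \o f); apply: bij_comp. Qed.

Lemma isomorphic_summand U V : isomorphic U V -> summand U V.
Proof. by move=> /isomorphicP[f [g [fK gK]]]; exists f, g. Qed.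

Lemma summand_trans V U W : summand U V -> summand V W -> summand U W.
Proof.
move=> [i [p ip]] [j [q jq]]; exists (j \o i), (p \o q) => x /=.
by rewrite jq ip.
Qed.

Lemma isomorphic_nonzero U V : isomorphic U V -> nonzero U -> nonzero V.
Proof.
move=> [f /bij_inj f_inj] [x x0]; exists (f x).
by rewrite -(linear0 f) (inj_eq f_inj).
Qed.

Lemma isomorphic_indecomposable U V :
  isomorphic U V -> indecomposable U -> indecomposable V.
Proof.
move=> UV [U0 Uind]; split; first exact: isomorphic_nonzero UV U0.
by move=> A B VAB; apply: Uind; apply: isomorphic_trans UV VAB.
Qed.

(** With [h = 1 - g], the module is the direct sum of the images of [g] and [h], so one of them is
    zero. *)
Lemma indecomposable_idempotent V (g : {linear V -> V}) :
  indecomposable V -> (forall x, g (g x) = g x) ->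
  (forall x, g x = 0) \/ (forall x, g x = x).
Proof.
move=> [_ Vind] gg.
pose h : {linear V -> V} := idfun \- g.
have hE x : h x = x - g x by [].
have gfix x : g x \in fixed_pred g by rewrite inE gg.
have hfix x : h x \in fixed_pred h by rewrite inE !hE linearB /= gg subrr subr0.
pose f x : (fixed_submod g * fixed_submod h)%type :=
  (FixedSubmod (gfix x), FixedSubmod (hfix x)).
have f_lin : linear f.
  move=> a x y; congr (_, _); apply: val_inj; first exact: (linearP g).
  exact: (linearP h).
pose fm := GRing.isLinear.Build R V _ _ f f_lin.
pose fl : {linear V -> (fixed_submod g * fixed_submod h)%type} := HB.pack f fm.
have f_bij : bijective fl.
  exists (fun u => val u.1 + val u.2) => [x|[[u ug] [v vh]]] /=.
    by rewrite addrC subrK.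
  have gu : g u = u by apply/eqP.
  have gv : g v = 0.
    by have := vh; rewrite inE hE -subr_eq0 addrAC subrr add0r oppr_eq0 => /eqP.
  congr (_, _); apply: val_inj => /=; first by rewrite linearD gu gv addr0.
  by rewrite linearD gu gv addr0 addrAC subrr add0r.
case: (EM (forall x, g x = 0)) => [|g0]; [by left | right => x].
apply/eqP; rewrite eq_sym -subr_eq0 -hE; apply/negP => /negP hx0.
case: (Vind _ _ (ex_intro _ fl f_bij)); split; last first.
  by exists (FixedSubmod (hfix x)); rewrite -val_eqE.
move/existsNP: g0 => [y /eqP gy].
by exists (FixedSubmod (gfix y)); rewrite -val_eqE.
Qed.

(** The idempotent [i \o p] of [V] is zero or the identity; zero is excluded because [p \o i] is the
    identity of the nonzero module [U]. *)
Lemma summand_indecomposable U V :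
  nonzero U -> indecomposable V -> summand U V -> isomorphic U V.
Proof.
move=> [x x0] Vind [i [p ip]].
have [|g0|g1] := indecomposable_idempotent (g := i \o p) Vind.
- by move=> y /=; rewrite ip.
- by move: x0; rewrite -(ip x) -(ip (p (i x))) -/((i \o p) _) g0 linear0 eqxx.
- by apply/isomorphicP; exists i, p.
Qed.

Definition iter_linear V (e : {linear V -> V}) n : {linear V -> V} :=
  iter n (fun f : {linear V -> V} => e \o f : {linear V -> V}) idfun.

Lemma iter_linearE V (e : {linear V -> V}) n x : iter_linear e n x = iter n e x.
Proof. by elim: n => //= n ->. Qed.

Lemma iter_idempotent (T : finType) (e : T -> T) :
  exists n, forall x, iter (n.+1 + n.+1) e x = iter n.+1 e x.
Proof.
(* There are more exponents than maps, so two powers of [e] coincide and the powers are periodic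
   from there on. *)
pose F (i : 'I_#|{ffun T -> T}|.+1) := [ffun x => iter i e x].
have /injectivePn[i [j ij Fij]] : ~~ injectiveb F.
  by apply/injectiveP => /leq_card; rewrite card_ord ltnn.
wlog {ij} ij : i j Fij / (i < j)%N.
  move=> IH; case: (ltngtP i j) ij => [ltij _|ltji _|/val_inj->].
  - exact: IH Fij ltij.
  - exact: IH (esym Fij) ltji.
  - by rewrite eqxx.
have per x m : iter (i + m) e x = iter (j + m) e x.
  have /ffunP/(_ (iter m e x)) := Fij.
  by rewrite !ffunE -!iterD.
have per' x m k : (i <= m)%N -> iter (m + k * (j - i)) e x = iter m e x.
  move=> im; elim: k => [|k IHk]; first by rewrite addn0.
  have -> : (m + k.+1 * (j - i) = j + (m + k * (j - i) - i))%N.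
    rewrite mulSn addnCA addnBAC ?(ltnW ij) // addnBA //.
    exact: leq_trans im (leq_addr _ _).
  by rewrite -per subnKC // (leq_trans im) ?leq_addr.
pose p := (j - i)%N.
have p0 : (0 < p)%N by rewrite subn_gt0.
(* The exponent [i.+1 * p] is positive, a multiple of the period [p], and at least [i], where
   periodicity starts. *)
exists (i.+1 * p).-1 => x.
rewrite prednK ?muln_gt0 // per' //.
by rewrite (leq_trans (leqnSn i)) // leq_pmulr.
Qed.

(* Fitting: some power of e is idempotent, hence 0 or the identity. *)
Lemma fitting Q (e : {linear Q -> Q}) : indecomposable Q ->
  exists n, (forall x, iter n.+1 e x = 0) \/ (forall x, iter n.+1 e x = x).
Proof.
move=> Qind; have [n en] := iter_idempotent e; exists n.
have [|e0|e1] := indecomposable_idempotent (g := iter_linear e n.+1) Qind.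
- by move=> x; rewrite !iter_linearE -iterD.
- by left=> x; rewrite -(e0 x) iter_linearE.
- by right=> x; rewrite -[RHS]e1 iter_linearE.
Qed.

(** The endomorphisms of [Q] through [V] and through [W] add up to the identity. If a power of the
    first is the identity, [Q] is a summand of [V]. Otherwise the first is nilpotent and fixes only
    zero, so the second is injective, hence bijective as [Q] is finite. *)
Lemma summand_prod Q V W : indecomposable Q -> summand Q (V * W)%type ->
  summand Q V \/ summand Q W.
Proof.
move=> Qind [i [p ip]].
pose iV : {linear Q -> V} := fst \o i.
pose iW : {linear Q -> W} := snd \o i.
have pV_lin : linear (fun v => p (v, 0)).
  move=> a u v; rewrite -linearP; congr (p (_, _)).
  by rewrite /= scaler0 addr0.
have pW_lin : linear (fun w => p (0, w)).
  move=> a u v; rewrite -linearP; congr (p (_, _)).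
  by rewrite /= scaler0 addr0.
pose pV : {linear V -> Q} :=
  HB.pack (fun v => p (v, 0)) (GRing.isLinear.Build R V Q _ _ pV_lin).
pose pW : {linear W -> Q} :=
  HB.pack (fun w => p (0, w)) (GRing.isLinear.Build R W Q _ _ pW_lin).
have pVW x : pV (iV x) + pW (iW x) = x.
  rewrite -[RHS]ip /= -linearD; congr (p _); case: (i x) => u v /=.
  by rewrite /GRing.add /= /add_pair /= addr0 add0r.
have [n [e0|e1]] := fitting (pV \o iV) Qind; last first.
  left; exists iV, (iter_linear (pV \o iV) n \o pV) => x /=.
  by rewrite iter_linearE -/((pV \o iV) x) -iterSr e1.
right.
have f_inj : injective (pW \o iW).
  apply: raddf_inj => x /= fx0.
  have ex : (pV \o iV) x = x by rewrite -[RHS]pVW /= fx0 addr0.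
  by rewrite -(e0 x) (iter_fix _ ex).
have [g [fK _]] := linear_bij_inv (injF_bij f_inj).
by exists iW, (g \o pW).
Qed.
End Summands.

(** * Counting homomorphisms *)

Section CountingSolutions.
Variable R : nzRingType.
Implicit Types M N : finLmodType R.

(** This counts the homomorphisms to [M] from the module with [l] generators and the rows of [A] as
    relations. *)
Definition nsol M k l (A : 'M[R]_(k, l)) : nat :=
  #|[set x : {ffun 'I_l -> M} | [forall i, \sum_j A i j *: x j == 0]]|.

Lemma nsol_fintype M (I J : finType) (A : I -> J -> R) :
  nsol M (\matrix_(i < #|I|, j < #|J|) A (enum_val i) (enum_val j)) =
  #|[set x : {ffun J -> M} | [forall i, \sum_j A i j *: x j == 0]]|.
Proof.
pose f (x : {ffun 'I_#|J| -> M}) : {ffun J -> M} := [ffun j => x (enum_rank j)].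
pose g (x : {ffun J -> M}) : {ffun 'I_#|J| -> M} := [ffun j => x (enum_val j)].
have fK : cancel f g by move=> x; apply/ffunP=> i; rewrite !ffunE enum_valK.
have gK : cancel g f by move=> x; apply/ffunP=> i; rewrite !ffunE enum_rankK.
rewrite /nsol -(card_imset _ (can_inj fK)); apply: eq_card => x.
rewrite -[x]gK (mem_imset _ _ (can_inj fK)) !inE gK.
have sumE i : \sum_(j < #|J|) A i (enum_val j) *: g x j = \sum_j A i j *: x j.
  rewrite [RHS](reindex _ (onW_bij _ (enum_val_bij J))).
  by apply: eq_bigr => j _; rewrite ffunE.
apply/forallP/forallP => /= x0 i.
  have := x0 (enum_rank i).
  by under eq_bigr do rewrite mxE enum_rankK; rewrite sumE.
by under eq_bigr do rewrite mxE; rewrite sumE.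
Qed.

Lemma nsol_nil M : nsol M (0 : 'M_(0, 1)) = #|M|.
Proof.
rewrite /nsol (eq_card (B := predT)); last first.
  by move=> x; rewrite !inE; apply/forallP => -[].
by rewrite card_ffun card_ord expn1.
Qed.

Lemma sum_indicator (I : finType) (V : lmodType R) (a : I) (f : I -> V) :
  \sum_i (i == a)%:R *: f i = f a.
Proof.
rewrite (bigD1 a) //= eqxx scale1r big1 ?addr0 // => i /negbTE ->.
by rewrite scale0r.
Qed.

Section HomCounting.
Variables (rs : seq R) (rsP : forall r, r \in rs) (M : finLmodType R).
Implicit Types (S : {set M}).

Definition homs S N : {set {ffun M -> N}} :=
  [set f : {ffun M -> N} | `[< linear f >] && [forall x in S, f x == 0]].

(** If the subset [S] is not a submodule, this is empty, so sums over kernels may run over all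
    subsets. *)
Definition homs_ker S N : {set {ffun M -> N}} :=
  [set f : {ffun M -> N} | `[< linear f >] && ([set x | f x == 0] == S)].

(* The equations defining a linear map that vanishes on S, the unknowns being
   its values. *)
Definition hom_row : finType := ('I_(size rs) * M * M + M)%type.
Definition hom_eqn S (i : hom_row) (z : M) : R :=
  match i with
  | inl (r, x, y) =>
      (z == rs`_r *: x + y)%:R - rs`_r * (z == x)%:R - (z == y)%:R
  | inr x => (x \in S)%:R * (z == x)%:R
  end.

(** As [rs] lists all scalars, linearity amounts to finitely many equations in the values of the
    map. *)
Lemma card_homs S N : #|homs S N| = nsol N
  (\matrix_(i < #|hom_row|, j < #|M|) hom_eqn S (enum_val i) (enum_val j)).
Proof.
rewrite nsol_fintype; apply: eq_card => f; rewrite !inE.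
have eqn_inl r x y : \sum_z hom_eqn S (inl (r, x, y)) z *: f z =
    f (rs`_r *: x + y) - rs`_r *: f x - f y.
  rewrite (eq_bigr (fun z => (z == rs`_r *: x + y)%:R *: f z -
    rs`_r *: ((z == x)%:R *: f z) - (z == y)%:R *: f z)).
    by rewrite !sumrB -scaler_sumr !sum_indicator.
  by move=> z _; rewrite !scalerBl scalerA.
have eqn_inr x : \sum_z hom_eqn S (inr x) z *: f z = (x \in S)%:R *: f x.
  rewrite -[f x in RHS](sum_indicator x f) scaler_sumr.
  by apply: eq_bigr => z _; rewrite scalerA.
apply/andP/forallP => [[/asboolP f_lin /forall_inP fS] [[[r x] y]|x]|f0].
- by rewrite eqn_inl f_lin addrAC addrK subrr.
- rewrite eqn_inr; case xS: (x \in S); last by rewrite scale0r.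
  by rewrite scale1r fS.
split; last first.
  by apply/forall_inP => x xS; have := f0 (inr x); rewrite eqn_inr xS scale1r.
apply/asboolP => r x y; have rn : (index r rs < size rs)%N by rewrite index_mem.
have := f0 (inl (Ordinal rn, x, y)).
by rewrite eqn_inl /= nth_index // -addrA -opprD subr_eq0 => /eqP.
Qed.

Lemma card_homs_ker S N :
  #|homs S N| = (\sum_(T : {set M} | S \subset T) #|homs_ker T N|)%N.
Proof.
pose ker (f : {ffun M -> N}) := [set x | f x == 0].
rewrite -sum1_card (partition_big ker (fun T => S \subset T)) => [|f];
    last first.
  rewrite inE => /andP[_ /forall_inP fS]; apply/subsetP => x xS.
  by rewrite inE fS.
apply: eq_bigr => T ST; rewrite -sum1_card; apply: eq_bigl => f.
rewrite !inE -andbA; congr (_ && _); apply/andP/idP => [[]//|fT]; split=> //.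
apply/forall_inP => x /(subsetP ST).
by rewrite -(eqP fT) inE.
Qed.

(* Moebius inversion, by downward induction on S. *)
Lemma eq_nsol_homs_ker N N' :
    (forall k l (A : 'M[R]_(k, l)), nsol N A = nsol N' A) ->
  forall S, #|homs_ker S N| = #|homs_ker S N'|.
Proof.
move=> eqN S; have [n] := ubnP #|~: S|.
elim: n S => // n IHn S; rewrite ltnS => Sn.
have := card_homs_ker S N; rewrite card_homs eqN -card_homs card_homs_ker.
rewrite (bigD1 S) //= [RHS](bigD1 S) //=.
rewrite (eq_bigr (fun T => #|homs_ker T N|)) => [/addIn//|T /andP[ST TS]].
apply/esym/IHn; apply: leq_trans Sn.
by apply: proper_card; rewrite properC properEneq eq_sym TS.
Qed.

(** The identity of [M] has kernel zero, so some homomorphism from [M] to [N] has kernel zero as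
    well; an injection between sets of equal size is bijective. *)
Lemma eq_nsol_isomorphic N :
    (forall k l (A : 'M[R]_(k, l)), nsol M A = nsol N A) ->
  isomorphic M N.
Proof.
move=> eqMN; have := eq_nsol_homs_ker eqMN [set 0].
have id_ker : [ffun x => x] \in homs_ker [set 0] M.
  rewrite inE; apply/andP; split.
    by apply/asboolP => a x y; rewrite !ffunE.
  by apply/eqP/setP => x; rewrite !inE ffunE.
move=> eqk; have /card_gt0P[f] : (0 < #|homs_ker [set 0%R] N|)%N.
  by rewrite -eqk; apply/card_gt0P; exists [ffun x => x].
rewrite inE => /andP[/asboolP f_lin /eqP/setP kerf].
pose fl : {linear M -> N} :=
  HB.pack (f : M -> N) (GRing.isLinear.Build R M N _ f f_lin).
exists fl; apply: inj_card_bij; last by rewrite -!nsol_nil eqMN.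
apply: raddf_inj => x /= fx0.
by have := kerf x; rewrite !inE fx0 eqxx => /esym/eqP.
Qed.

End HomCounting.
End CountingSolutions.

(** A system is solved in a product exactly when it is solved in each factor. Giving the product by
    its projections [f] covers binary products, powers and dependent sums alike. *)
Lemma nsol_prod (R : nzRingType) (I : finType) (V : I -> finLmodType R)
    (M : finLmodType R) (f : forall i, {linear M -> V i})
    k l (A : 'M[R]_(k, l)) :
    bijective (fun x => [ffun i => f i x] : {dffun forall i, V i}) ->
  nsol M A = (\prod_i nsol (V i) A)%N.
Proof.
case=> g fK gK.
pose F (x : {ffun 'I_l -> M}) : {dffun forall i, {ffun 'I_l -> V i}} :=
  [ffun i => [ffun j => f i (x j)]].
pose G (y : {dffun forall i, {ffun 'I_l -> V i}}) : {ffun 'I_l -> M} :=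
  [ffun j => g [ffun i => y i j]].
have FK : cancel F G.
  move=> x; apply/ffunP => j; rewrite ffunE -[RHS]fK; congr (g _).
  by apply/ffunP => i; rewrite !ffunE.
have GK : cancel G F.
  move=> y; apply/ffunP => i; rewrite ffunE; apply/ffunP => j; rewrite !ffunE.
  by have /ffunP/(_ i) := gK [ffun i => y i j]; rewrite !ffunE.
rewrite {1}/nsol -(card_imset _ (can_inj FK)).
rewrite -cardsXn; apply: eq_card => y.
rewrite -[y]GK (mem_imset _ _ (can_inj FK)) inE.
set x := G y; apply/forallP/setXnP => /= [x0 i|x0 r].
  rewrite inE; apply/forallP => r; have /eqP/(congr1 (f i)) := x0 r.
  rewrite linear0 linear_sum => fx0; apply/eqP; rewrite -[RHS]fx0.
  by apply: eq_bigr => j _; rewrite !ffunE linearZ.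
apply/eqP/(can_inj fK)/ffunP => i; rewrite !ffunE linear0 linear_sum.
have := x0 i; rewrite inE => /forallP/(_ r)/eqP fx0; rewrite -[RHS]fx0.
by apply: eq_bigr => j _; rewrite !ffunE linearZ.
Qed.

(** * Nullities of matrices over a finite field *)

Section FinitelyGenerated.
Variables (K : finFieldType) (R : falgType K).

(** Coordinates over [K] make [M] a finite module; this synonym carries that structure. *)
Definition finmod (M : fgModule R) : predArgType := M.
HB.instance Definition _ (M : fgModule R) := GRing.Lmodule.on (finmod M).
HB.instance Definition _ (M : fgModule R) := isCountable.Build (finmod M)
  (pcan_pickleK (can_pcan (@VectorInternalTheory.v2rK _ (kspace M)))).
HB.instance Definition _ (M : fgModule R) := isFinite.Build (finmod M)
  (@pcan_enumP (finmod M) _ _ _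
    (can_pcan (@VectorInternalTheory.v2rK _ (kspace M)))).

(** Up to the dimension of [M] this is equivalent to the rank but, unlike the normalised [rk], it is
    additive in [M]. *)
Definition nul (M : fgModule R) k l (A : 'M[R]_(k, l)) : nat :=
  \dim (lker (linfun (mxact (M := M) A))).

Lemma dim_lker_limg (M : fgModule R) k l (A : 'M[R]_(k, l)) :
  (nul M A + \dim (limg (linfun (mxact (M := M) A))) = l * kdim M)%N.
Proof.
have := limg_ker_dim (linfun (mxact (M := M) A)) fullv.
rewrite capfv => ->; rewrite /kdim !dimvf.
by rewrite {1}/dim /= card_ord.
Qed.

Lemma rkE (M : fgModule R) k l (A : 'M[R]_(k, l)) :
  rk M A = (l * kdim M)%:R / (kdim M)%:R - (nul M A)%:R / (kdim M)%:R.
Proof. by rewrite -mulrBl -(dim_lker_limg _ A) natrD addrAC subrr add0r. Qed.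

Lemma nul_nsol (M : fgModule R) k l (A : 'M[R]_(k, l)) :
  (#|K| ^ nul M A)%N = nsol (finmod M) A.
Proof.
pose W := finvect_type {ffun 'I_l -> kspace M}.
pose h (x : {ffun 'I_l -> finmod M}) : W := x.
have hI : injective h by [].
rewrite /nul /nsol -(card_imset _ hI).
have := @card_vspace K W (Vector.class W) (lker (linfun (mxact (M := M) A))).
move=> <-; apply: eq_card => x.
rewrite -[x in RHS]/(h x) (mem_imset _ _ hI) inE memv_ker lfunE /=.
apply/eqP/forallP => [/ffunP x0 i|x0]; last apply/ffunP => i.
  by have := x0 i; rewrite !ffunE => /eqP.
by rewrite !ffunE; exact/eqP/x0.
Qed.
End FinitelyGenerated.

Lemma finitely_generated_cover (R : nzRingType) (V : lmodType R) (T : finType)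
  (f : T -> V) : (forall x, exists t, f t = x) -> finitely_generated V.
Proof.
move=> f_surj; exists #|T|, (f \o enum_val) => x.
have [t <-] := f_surj x; exists (fun i => (i == enum_rank t)%:R).
by rewrite sum_indicator /= enum_rankK.
Qed.

Section Nullity.
Variables (K : finFieldType) (R : falgType K).
Implicit Types (M N P Q : fgModule R) (L : seq (fgModule R)).

Lemma finmod_isomorphic M : isomorphic M (finmod M).
Proof.
have id_lin : linear (id : M -> finmod M) by [].
pose f : {linear M -> finmod M} :=
  HB.pack (id : M -> finmod M)
    (GRing.isLinear.Build R M (finmod M) _ id id_lin).
by exists f; exists id.
Qed.

Fact fgprod_subproof M N : finitely_generated (M * N)%type.
Proof.
pose f (x : (finmod M * finmod N)%type) : (M * N)%type := x.
by apply: (finitely_generated_cover (f := f)) => x; exists x.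
Qed.
Definition fgprod M N : fgModule R := FgModule (fgprod_subproof M N).

Fact fgpow_subproof n M : finitely_generated {ffun 'I_n -> M}.
Proof.
pose f (x : {ffun 'I_n -> finmod M}) : {ffun 'I_n -> M} := x.
by apply: (finitely_generated_cover (f := f)) => x; exists x.
Qed.
Definition fgpow n M : fgModule R := FgModule (fgpow_subproof n M).

Fact fgdsum_subproof (I : finType) (V : I -> fgModule R) :
  finitely_generated (dsum (fun i => V i : lmodType R)).
Proof.
pose f (x : {dffun forall i, finmod (V i)}) :
  dsum (fun i => V i : lmodType R) := x.
by apply: (finitely_generated_cover (f := f)) => x; exists x.
Qed.
Definition fgdsum (I : finType) (V : I -> fgModule R) : fgModule R :=
  FgModule (fgdsum_subproof V).

Lemma nul_prod (I : finType) (V : I -> fgModule R) M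
    (f : forall i, {linear M -> V i}) k l (A : 'M[R]_(k, l)) :
    bijective (fun x => [ffun i => f i x] : {dffun forall i, V i}) ->
  nul M A = (\sum_i nul (V i) A)%N.
Proof.
move=> fbij; apply/eqP; rewrite -(eqn_exp2l _ _ (finNzRing_gt1 K)) expn_sum.
rewrite nul_nsol; apply/eqP.
under eq_bigr do rewrite nul_nsol.
have f_lin i : linear (f i : finmod M -> finmod (V i)).
  by move=> a x y; apply: linearP.
pose F i : {linear finmod M -> finmod (V i)} :=
  HB.pack (f i : finmod M -> finmod (V i))
    (GRing.isLinear.Build R (finmod M) (finmod (V i)) _ _ (f_lin i)).
exact: (nsol_prod (f := F)).
Qed.

Lemma nul_isomorphic M N k l (A : 'M[R]_(k, l)) :
  isomorphic M N -> nul M A = nul N A.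
Proof.
case=> f [g fK gK].
rewrite (nul_prod (I := unit) (V := fun=> N) (f := fun=> f)).
  by rewrite (big_pred1 tt) // => -[].
exists (fun h : {dffun forall i : unit, N} => g (h tt)) => [x|h].
  by rewrite ffunE.
by apply/ffunP => -[]; rewrite ffunE gK.
Qed.

Lemma nul_fgprod M N k l (A : 'M[R]_(k, l)) :
  nul (fgprod M N) A = (nul M A + nul N A)%N.
Proof.
pose V (b : bool) := if b then M else N.
pose f b : {linear fgprod M N -> V b} :=
  if b return {linear fgprod M N -> V b} then fst else snd.
rewrite (nul_prod (V := V) (f := f)); first by rewrite big_bool.
exists (fun h : {dffun forall b, V b} => (h true, h false)) => [[x y]|h].
  by rewrite !ffunE.
by apply/ffunP => -[]; rewrite !ffunE.
Qed.

Lemma nul_fgpow n M k l (A : 'M[R]_(k, l)) :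
  nul (fgpow n M) A = (n * nul M A)%N.
Proof.
have ev_lin i : linear (fun x : fgpow n M => (x : {ffun _ -> _}) i : M).
  by move=> a x y; rewrite !ffunE.
pose f i : {linear fgpow n M -> M} :=
  HB.pack (fun x : fgpow n M => (x : {ffun _ -> _}) i : M)
   (GRing.isLinear.Build R (fgpow n M) M _ _ (ev_lin i)).
rewrite (nul_prod (V := fun=> M) (f := f)).
  by rewrite sum_nat_const card_ord.
by exists id => x; apply/ffunP => i; rewrite ffunE.
Qed.

Lemma nul_fgdsum (I : finType) (V : I -> fgModule R) k l (A : 'M[R]_(k, l)) :
  nul (fgdsum V) A = (\sum_i nul (V i) A)%N.
Proof.
have ev_lin i :
    linear (fun x : fgdsum V => (x : {dffun forall i, V i}) i : V i).
  by move=> a x y; rewrite !ffunE.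
pose f i : {linear fgdsum V -> V i} :=
  HB.pack (fun x : fgdsum V => (x : {dffun forall i, V i}) i : V i)
   (GRing.isLinear.Build R (fgdsum V) (V i) _ _ (ev_lin i)).
rewrite (nul_prod (f := f)) //.
by exists id => x; apply/ffunP => i; rewrite ffunE.
Qed.

(** One unknown without equations has the whole module as solutions; additivity and invariance of
    nullities thus carry over to dimensions. *)
Lemma kdimE M : kdim M = nul M (0 : 'M_(0, 1)).
Proof.
rewrite -[LHS]mul1n -(dim_lker_limg M (0 : 'M_(0, 1))).
have := dimvS (subvf (limg (linfun (mxact (M := M) (0 : 'M_(0, 1)))))).
rewrite [X in (_ <= X)%N]dimvf [X in (_ <= X)%N]/dim /= card_ord leqn0.
by move=> /eqP->; rewrite addn0.
Qed.

Lemma card_finmod M : #|finmod M| = (#|K| ^ kdim M)%N.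
Proof. by rewrite kdimE nul_nsol nsol_nil. Qed.

Lemma kdim_gt0 M : nonzero M -> (0 < kdim M)%N.
Proof.
move=> [x x0]; rewrite lt0n; apply: contra x0 => /eqP M0.
have /fintype_le1P : (#|finmod M| <= 1)%N by rewrite card_finmod M0.
by move=> /(_ x 0) xE; apply/eqP.
Qed.

Lemma eq_nul_isomorphic M N :
  (forall k l (A : 'M[R]_(k, l)), nul M A = nul N A) -> isomorphic M N.
Proof.
move=> eqMN; apply: isomorphic_trans (finmod_isomorphic M) _.
apply: isomorphic_trans (isomorphic_sym (finmod_isomorphic N)).
(* A finite dimensional algebra over a finite field is finite, so its scalars can be listed. *)
pose rs : seq R := enum (finvect_type R).
have rsP r : r \in rs by rewrite (mem_enum (finvect_type R)).
apply: (eq_nsol_isomorphic rsP).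
by move=> k l A; rewrite -!nul_nsol eqMN.
Qed.
End Nullity.

(** * Decomposition into indecomposables *)

Section KrullSchmidt.
Variables (K : finFieldType) (R : falgType K).
Implicit Types (M N P Q : fgModule R) (L : seq (fgModule R)).

Definition isomorphicb Q P : bool := `[< isomorphic Q P >].
Definition all_indec L : bool := all (fun P => `[< indecomposable P >]) L.
Definition nuls L k l (A : 'M[R]_(k, l)) : nat := (\sum_(P <- L) nul P A)%N.

Lemma isomorphicbP Q P : reflect (isomorphic Q P) (isomorphicb Q P).
Proof. exact: asboolP. Qed.

Lemma isomorphicb_refl P : isomorphicb P P.
Proof. exact/isomorphicbP/isomorphic_refl. Qed.

Fixpoint fgsum L : fgModule R :=
  if L is P :: L' then fgprod P (fgsum L')
  else fgdsum (fun i : void => match i with end).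

Lemma nul_fgsum L k l (A : 'M[R]_(k, l)) : nul (fgsum L) A = nuls L A.
Proof.
rewrite /nuls; elim: L => [|P L IHL] /=.
  by rewrite big_nil nul_fgdsum big_pred0.
by rewrite big_cons nul_fgprod IHL.
Qed.

(** Fitting's argument needs a finite module, so [Q] is replaced by its finite copy. *)
Lemma summand_fgprod Q M N : indecomposable Q -> summand Q (M * N)%type ->
  summand Q M \/ summand Q N.
Proof.
move=> Qind QMN; have Qf := finmod_isomorphic Q; have fQ := isomorphic_sym Qf.
have := summand_prod (isomorphic_indecomposable Qf Qind)
  (summand_trans (isomorphic_summand fQ) QMN).
by case=> /(summand_trans (isomorphic_summand Qf)); [left | right].
Qed.

(** Splitting off the head of [L] repeatedly, [Q] becomes a summand of a member, hence isomorphic to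
    it, or of the zero module, which is impossible. *)
Lemma summand_fgsum Q L : indecomposable Q -> all_indec L ->
  summand Q (fgsum L) -> has (isomorphicb Q) L.
Proof.
move=> Qind; elim: L => [_ [i [p ip]]|P L IHL /= /andP[/asboolP Pind Lind]].
  have [[x /negP x0] _] := Qind; case: x0.
  rewrite -(ip x) (_ : i x = 0) ?linear0 //.
  by apply/ffunP => -[].
move=> /summand_fgprod[//|QP|/IHL->//]; last exact: orbT.
apply/orP; left; apply/isomorphicbP; apply: summand_indecomposable QP => //.
by case: Qind.
Qed.

Lemma all_indec_cat L1 L2 : all_indec (L1 ++ L2) = all_indec L1 && all_indec L2.
Proof. exact: all_cat. Qed.

Lemma all_indec_flatten (ss : seq (seq (fgModule R))) :
  all_indec (flatten ss) = all all_indec ss.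
Proof. by elim: ss => //= L ss <-; rewrite all_indec_cat. Qed.

Lemma eq_isomorphicb Q P P' :
  isomorphic P P' -> isomorphicb Q P = isomorphicb Q P'.
Proof.
move=> PP'; apply/asboolP/asboolP => /isomorphic_trans; apply=> //.
exact: isomorphic_sym.
Qed.

Lemma split_isomorphicb Q L : has (isomorphicb Q) L ->
  exists P L1 L2, [/\ L = L1 ++ P :: L2 & isomorphic Q P].
Proof.
by case/split_find => P L1 L2 /asboolP QP _; exists P, L1, L2; rewrite cat_rcons.
Qed.

(* The functions nul Q, for Q indecomposable up to isomorphism, are linearly
   independent: the indecomposables of both lists are cancelled one by one. *)
Lemma eq_nuls_count L L' : all_indec L -> all_indec L' ->
    (forall k l (A : 'M[R]_(k, l)), nuls L A = nuls L' A) ->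
  forall Q, count (isomorphicb Q) L = count (isomorphicb Q) L'.
Proof.
elim: L L' => [|P L IHL] L' Lind L'ind eqLL' Q.
  case: L' L'ind eqLL' => // P L' /= /andP[/asboolP[/kdim_gt0 P0 _] _].
  move=> /(_ _ _ (0 : 'M_(0, 1))) /eqP; rewrite /nuls big_nil big_cons -kdimE.
  by rewrite eq_sym addn_eq0 -leqn0 leqNgt P0.
have [/asboolP Pind {}Lind] := andP Lind.
(* By Lovasz' argument the sums are isomorphic, so [P] is a summand of the second one and has an
   isomorphic partner in [L'] to cancel. *)
have iso : isomorphic (fgsum (P :: L)) (fgsum L').
  by apply: eq_nul_isomorphic => k l A; rewrite !nul_fgsum.
have : summand P (fgsum L').
  apply: summand_trans (isomorphic_summand iso).
  have in_lin : linear (fun x : P => (x, 0) : P * fgsum L).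
    by move=> a x y; congr (_, _); rewrite /= scaler0 addr0.
  pose i : {linear P -> fgprod P (fgsum L)} :=
    HB.pack (fun x : P => (x, 0) : P * fgsum L)
      (GRing.isLinear.Build R P (fgprod P (fgsum L)) _ _ in_lin).
  pose p : {linear fgprod P (fgsum L) -> P} := fst.
  by exists i, p.
move=> /(summand_fgsum Pind L'ind)/split_isomorphicb[P' [L1 [L2 [defL' PP']]]].
move: L'ind eqLL'; rewrite {}defL' all_indec_cat /=.
move=> /and3P[L1ind _ L2ind] eqLL'.
have := IHL (L1 ++ L2) Lind _ _ Q; rewrite !count_cat /= => ->.
- by rewrite (eq_isomorphicb Q PP') addnCA.
- by rewrite all_indec_cat L1ind.
move=> k l A; have := eqLL' k l A.
rewrite /nuls !big_cat !big_cons /= (nul_isomorphic A PP') [RHS]addnCA.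
exact: addnI.
Qed.

(** Equal counts provide for the head of [L] an isomorphic partner in [L']; both are removed and
    contribute the same nullities. *)
Lemma eq_count_nuls L L' : all_indec L -> all_indec L' ->
    (forall Q, indecomposable Q ->
      count (isomorphicb Q) L = count (isomorphicb Q) L') ->
  forall k l (A : 'M[R]_(k, l)), nuls L A = nuls L' A.
Proof.
elim: L L' => [|P L IHL] L' Lind L'ind eqLL' k l A.
  case: L' L'ind eqLL' => // P L' /= /andP[/asboolP Pind _] /(_ P Pind) /=.
  by rewrite isomorphicb_refl.
have [/asboolP Pind {}Lind] := andP Lind.
have : has (isomorphicb P) L'.
  rewrite has_count -eqLL' //=.
  by rewrite isomorphicb_refl.
move=> /split_isomorphicb[P' [L1 [L2 [defL' PP']]]].
move: L'ind eqLL'; rewrite {}defL' all_indec_cat /=.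
move=> /and3P[L1ind _ L2ind] eqLL'.
rewrite /nuls big_cat !big_cons /= -(nul_isomorphic A PP') addnCA -big_cat /=.
congr (_ + _)%N; apply: IHL => // [|Q Qind].
  by rewrite all_indec_cat L1ind.
have := eqLL' Q Qind; rewrite !count_cat /= -(eq_isomorphicb Q PP') addnCA.
exact: addnI.
Qed.

Lemma finitely_generated_isomorphic (V W : lmodType R) : isomorphic V W ->
  finitely_generated V -> finitely_generated W.
Proof.
move=> [f [g fK gK]] [n [h hP]]; exists n, (f \o h) => x.
have [c gx] := hP (g x); exists c.
by rewrite -[LHS]gK gx linear_sum; apply: eq_bigr => i _; rewrite linearZ.
Qed.

(** Since [indecomposable] speaks of splittings into arbitrary modules, their factors must be shown
    to be finitely generated. *)
Lemma finitely_generated_prodl (V W : lmodType R) :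
  finitely_generated (V * W)%type -> finitely_generated V.
Proof.
move=> [n [h hP]]; exists n, (fst \o h) => x.
have [c gx] := hP (x, 0); exists c.
rewrite -[LHS]/(fst (x, 0 : W)) gx linear_sum.
by apply: eq_bigr => i _; rewrite linearZ.
Qed.

Lemma finitely_generated_prodr (V W : lmodType R) :
  finitely_generated (V * W)%type -> finitely_generated W.
Proof.
move=> [n [h hP]]; exists n, (snd \o h) => x.
have [c gx] := hP (0, x); exists c.
rewrite -[LHS]/(snd (0 : V, x)) gx linear_sum.
by apply: eq_bigr => i _; rewrite linearZ.
Qed.

(** By induction on the dimension: a nonzero decomposable module splits into two factors of smaller
    dimension, whose lists are concatenated. *)
Lemma exists_indec_list M : exists2 L, all_indec L &
  forall k l (A : 'M[R]_(k, l)), nul M A = nuls L A.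
Proof.
have [n] := ubnP (kdim M); elim: n M => // n IHn M; rewrite ltnS => Mn.
have [M0|M0] := EM (nonzero M); last first.
  exists [::] => // k l A; rewrite -nul_fgsum; apply: nul_isomorphic.
  have M00 (x : M) : x = 0 by apply: contra_notP M0 => /eqP; exists x.
  exists (\0 : {linear M -> fgsum [::]}); exists (fun=> 0) => x.
    by rewrite [RHS]M00.
  by apply/ffunP => -[].
have [Mind|Mdec] := EM (indecomposable M).
  exists [:: M] => [|k l A]; last by rewrite /nuls big_seq1.
  by rewrite /= andbT; apply/asboolP.
have [V [W [MVW [V0 W0]]]] : exists V W : lmodType R,
    isomorphic M (V * W)%type /\ nonzero V /\ nonzero W.
  apply: contra_notP Mdec => Mdec; split=> // V W MVW VW0.
  by apply: Mdec; exists V, W.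
have VWfg := finitely_generated_isomorphic MVW (fgP M).
pose V' := FgModule (finitely_generated_prodl VWfg).
pose W' := FgModule (finitely_generated_prodr VWfg).
have nulE k l (A : 'M_(k, l)) : nul M A = (nul V' A + nul W' A)%N.
  by rewrite -nul_fgprod; apply: nul_isomorphic.
have dimE : kdim M = (kdim V' + kdim W')%N by rewrite !kdimE.
have V'0 : (0 < kdim V')%N by apply: kdim_gt0.
have W'0 : (0 < kdim W')%N by apply: kdim_gt0.
have [|L1 L1ind L1E] := IHn V'.
  by apply: leq_trans Mn; rewrite dimE -addn1 leq_add2l.
have [|L2 L2ind L2E] := IHn W'.
  by apply: leq_trans Mn; rewrite dimE -add1n leq_add2r.
exists (L1 ++ L2) => [|k l A]; first by rewrite all_indec_cat L1ind.
by rewrite nulE L1E L2E /nuls big_cat.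
Qed.

Lemma group_indec_list L : all_indec L ->
  exists (s : nat) (P : 'I_s -> fgModule R) (n : 'I_s -> nat),
  [/\ forall i, indecomposable (P i),
      forall i j, isomorphic (P i) (P j) -> i = j,
      forall i, (0 < n i)%N
    & forall k l (A : 'M[R]_(k, l)), nuls L A = (\sum_i n i * nul (P i) A)%N].
Proof.
elim: L => [_|Q L IHL /= /andP[/asboolP Qind /IHL]].
  have e (T : Type) (i : 'I_0) : T by case: i.
  exists 0%N, (fun i => e _ i), (fun i => e _ i);
  split=> [[]//|[]//|[]//|k l A].
  by rewrite /nuls big_nil big_ord0.
move=> [s [P [n [Pind Pinj n0 LE]]]].
have [[i0 QP]|QP] := EM (exists i, isomorphic Q (P i)).
  exists s, P, (fun i => n i + (i == i0))%N; split=> // [i|k l A].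
    by rewrite addn_gt0 n0.
  under eq_bigr do rewrite mulnDl; rewrite big_split /= -LE.
  rewrite (bigD1 i0 (F := fun i => (_ * _)%N)) //= eqxx mul1n big1 ?addn0.
    by rewrite /nuls big_cons addnC (nul_isomorphic A QP).
  by move=> i /negbTE->.
(* [Q] opens a new isomorphism class, placed at index 0 with multiplicity 1; the old classes move up
   by one. *)
exists s.+1, (fun i => if unlift ord0 i is Some j then P j else Q),
  (fun i => if unlift ord0 i is Some j then n j else 1%N).
split=> [i|i j|i|k l A].
- by case: unliftP.
- case: unliftP => [i' ->|->]; case: unliftP => [j' ->|->] // iso.
  + by rewrite (Pinj _ _ iso).
  + by case: QP; exists i'; apply: isomorphic_sym.
  + by case: QP; exists j'.
- by case: unliftP.
rewrite /nuls big_cons big_ord_recl unlift_none mul1n; congr (_ + _)%N.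
by rewrite -[LHS]/(nuls L A) LE; apply: eq_bigr => i _; rewrite liftK.
Qed.

(** * Krull-Schmidt decompositions and weights *)

Definition ks_module s (P : 'I_s -> fgModule R) (n : 'I_s -> nat) : fgModule R :=
  fgdsum (fun i => fgpow (n i) (P i)).

Lemma nul_ks_module s (P : 'I_s -> fgModule R) n k l (A : 'M[R]_(k, l)) :
  nul (ks_module P n) A = (\sum_i n i * nul (P i) A)%N.
Proof. by rewrite nul_fgdsum; apply: eq_bigr => i _; rewrite nul_fgpow. Qed.

(** A decomposition on the level of nullities suffices, because equal nullities give an
    isomorphism. *)
Lemma krull_schmidt_exists M : exists (s : nat) (P : 'I_s -> fgModule R) n,
  krull_schmidt_decomposition M P n.
Proof.
have [L /group_indec_list[s [P [n [Pind Pinj n0 LE]]]] ME] := exists_indec_list M.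
exists s, P, n; split=> //; suff : isomorphic M (ks_module P n) by [].
by apply: eq_nul_isomorphic => k l A; rewrite nul_ks_module ME LE.
Qed.

(** This is the uniqueness part of Krull-Schmidt: written out as a list with repetitions, any
    decomposition has the nullities of [L], hence its counts. *)
Lemma krull_schmidt_count M L s (P : 'I_s -> fgModule R) n :
    all_indec L -> (forall k l (A : 'M[R]_(k, l)), nul M A = nuls L A) ->
    krull_schmidt_decomposition M P n ->
  forall Q, count (isomorphicb Q) L = (\sum_i n i * isomorphicb Q (P i))%N.
Proof.
move=> Lind ME [Pind _ _ iso] Q.
pose L' := flatten [seq nseq (n i) (P i) | i <- enum 'I_s].
rewrite (eq_nuls_count (L' := L') Lind).
- rewrite count_flatten -map_comp sumnE big_map big_enum.
  by apply: eq_bigr => i _; rewrite /= count_nseq mulnC.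
- rewrite all_indec_flatten all_map; apply/allP => i _ /=.
  by rewrite /all_indec all_nseq; apply/orP; right; apply/asboolP.
move=> k l A; rewrite -ME (nul_isomorphic (N := ks_module P n) A iso) nul_ks_module.
rewrite /nuls big_flatten big_map big_enum; apply: eq_bigr => i _.
by rewrite big_nseq iter_addn_0 mulnC.
Qed.

(** Uniqueness of the multiplicities forces every weight to equal the right-hand side, and existence
    of a decomposition provides a weight, so [xget] returns this value. *)
Lemma weightE M L Q :
    all_indec L -> (forall k l (A : 'M[R]_(k, l)), nul M A = nuls L A) ->
  weight Q M = (count (isomorphicb Q) L)%:R * (kdim Q)%:R / (kdim M)%:R.
Proof.
move=> Lind ME; set w := RHS.
have wP w' : is_weight Q M w' -> w' = w.
  move=> [s [P [n [ks Qw']]]]; rewrite /w (krull_schmidt_count Lind ME ks).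
  have [_ Pinj _ _] := ks.
  case: Qw' => [[i QP ->]|[QP ->]]; last first.
    by rewrite big1 ?mul0r // => i _; rewrite (introF (isomorphicbP _ _)) ?muln0.
  rewrite (bigD1 i) //= (introT (isomorphicbP _ _) QP) muln1 big1 ?addn0.
    by rewrite !kdimE (nul_isomorphic _ QP).
  move=> j ji; rewrite (introF (isomorphicbP _ _)) ?muln0 // => QPj.
  by case/eqP: ji; apply: Pinj; apply: isomorphic_trans QP; apply: isomorphic_sym.
have [s [P [n ks]]] := krull_schmidt_exists M.
have [w' w'P] : exists w', is_weight Q M w'.
  have [[i QP]|QP] := EM (exists i, isomorphic Q (P i)).
    by eexists; exists s, P, n; split=> //; left; exists i.
  exists 0, s, P, n; split=> //; right; split=> // i QPi.
  by apply: QP; exists i.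
apply: classical_sets.xget_subset1; first by rewrite -(wP _ w'P).
by move=> x y /= /wP-> /wP->.
Qed.

(** * Rank functions against weights *)

Definition copies n L : seq (fgModule R) := flatten (nseq n L).

Lemma all_indec_copies n L : all_indec L -> all_indec (copies n L).
Proof. by move=> Lind; rewrite all_indec_flatten all_nseq Lind orbT. Qed.

Lemma count_copies n L Q :
  count (isomorphicb Q) (copies n L) = (n * count (isomorphicb Q) L)%N.
Proof. by rewrite count_flatten map_nseq sumn_nseq mulnC. Qed.

Lemma nuls_copies n L k l (A : 'M[R]_(k, l)) :
  nuls (copies n L) A = (n * nuls L A)%N.
Proof. by rewrite /nuls big_flatten big_nseq iter_addn_0 mulnC. Qed.

Lemma eq_divr_nat (a b m n : nat) : (0 < m)%N -> (0 < n)%N ->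
  (a%:R / m%:R = b%:R / n%:R :> rat) <-> (n * a = m * b)%N.
Proof.
move=> m0 n0; have m0' : m%:R != 0 :> rat by rewrite pnatr_eq0 -lt0n.
have n0' : n%:R != 0 :> rat by rewrite pnatr_eq0 -lt0n.
by rewrite (rwP eqP) eqr_div // -!natrM eqr_nat -(rwP eqP) (mulnC n) (mulnC m).
Qed.

(** Each rank is [l] minus the nullity divided by the dimension; clearing denominators compares the
    nullities of the powers [M^(dim N)] and [N^(dim M)]. *)
Lemma same_rkP M N : nonzero M -> nonzero N ->
  same_rk M N <->
  forall k l (A : 'M[R]_(k, l)), (kdim N * nul M A = kdim M * nul N A)%N.
Proof.
move=> /kdim_gt0 M0 /kdim_gt0 N0.
have rkM (V : fgModule R) k l (A : 'M_(k, l)) : (0 < kdim V)%N ->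
    rk V A = l%:R - (nul V A)%:R / (kdim V)%:R.
  by move=> V0; rewrite rkE natrM mulfK // pnatr_eq0 -lt0n.
split=> eqMN k l A; last first.
  by rewrite !rkM //; congr (_ - _); apply/eq_divr_nat.
apply/eq_divr_nat => //; have := eqMN k l A; rewrite !rkM //.
by move/addrI/oppr_inj.
Qed.

(** Both sides become statements on the lists of indecomposables of [M^(dim N)] and [N^(dim M)]:
    equal nullities on one side, equal counts on the other. *)
Lemma same_rk_weight M N : nonzero M -> nonzero N ->
  same_rk M N <-> forall Q, indecomposable Q -> weight Q M = weight Q N.
Proof.
move=> M0 N0; have [LM LMind ME] := exists_indec_list M.
have [LN LNind NE] := exists_indec_list N.
have kM0 := kdim_gt0 M0; have kN0 := kdim_gt0 N0.
(* Cross-multiplying the weights leaves a common factor [kdim Q], which is positive and cancels. *)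
have weight_count Q : indecomposable Q -> (weight Q M = weight Q N <->
    count (isomorphicb Q) (copies (kdim N) LM) =
    count (isomorphicb Q) (copies (kdim M) LN)).
  move=> [/kdim_gt0 Q0 _]; rewrite !count_copies.
  rewrite (weightE _ LMind) // (weightE _ LNind) // -!natrM.
  split=> [/(eq_divr_nat _ _ kM0 kN0)/eqP|eqc].
    by rewrite !mulnA eqn_pmul2r // => /eqP.
  by apply/(eq_divr_nat _ _ kM0 kN0); rewrite !mulnA eqc.
have [iM iN] :=
  (all_indec_copies (kdim N) LMind, all_indec_copies (kdim M) LNind).
split=> [/(same_rkP M0 N0) eqMN Q /weight_count->|eqw].
  by apply: eq_nuls_count => // k l A; rewrite !nuls_copies -ME -NE.
apply/(same_rkP M0 N0) => k l A; rewrite ME NE -!nuls_copies.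
by apply: eq_count_nuls => // Q Qind; apply/weight_count/eqw.
Qed.

Lemma weight_indec P Q : indecomposable P ->
  weight Q P = (isomorphicb Q P)%:R * (kdim Q)%:R / (kdim P)%:R.
Proof.
move=> Pind; rewrite (weightE (L := [:: P])) /= ?andbT ?addn0 //.
  exact/asboolP.
by move=> k l A; rewrite /nuls big_seq1.
Qed.

End KrullSchmidt.

(* Elements of Ind(R) are given by representatives: Q ranges over the finitely
   generated indecomposable modules, and distinct means non-isomorphic. *)
Theorem proposition4p1 (K : finFieldType) (R : falgType K) :
  (forall M N : fgModule R, nonzero M -> nonzero N ->
     (same_rk M N <->
      forall Q : fgModule R, indecomposable Q -> weight Q M = weight Q N)) /\
  (forall P Q : fgModule R, indecomposable P -> indecomposable Q ->
     ~ isomorphic P Q -> ~ same_rk Q P).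
Proof.
split; first exact: same_rk_weight.
move=> P Q Pind Qind PQ.
have [[P0 _] [Q0 _]] := (Pind, Qind).
(* The weight of [P] is 0 in [Q] and 1 in [P]. *)
move=> /(same_rk_weight Q0 P0)/(_ P Pind); rewrite !weight_indec //.
rewrite (introF (isomorphicbP _ _) PQ) isomorphicb_refl.
rewrite !mul0r mul1r => /esym/eqP; rewrite divff ?oner_eq0 //.
by rewrite pnatr_eq0 -lt0n kdim_gt0.
Qed.
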